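(* Let $k\ge2$ be an integer and $\rho^\infty\in[0,1]$. Consider the $k$-equation generalized-$\alpha$ method (defined in the context) with all user parameters equal, $\rho^\infty_1=\dots=\rho^\infty_k=\rho^\infty$, i.e. with $$\alpha_j=\frac12\Big(\frac{3+\rho^\infty}{1+\rho^\infty}\Big),\quad \gamma_j=\alpha_j-\tfrac12\quad(j=1,\dots,k-1),\qquad \alpha_k=\frac12\Big(\frac{3-\rho^\infty}{1+\rho^\infty}\Big),\quad \alpha_f=\frac{1}{1+\rho^\infty},\quad \gamma_k=\tfrac12-\alpha_f+\alpha_k.$$ Then the spectral radius of the amplification matrix $G(\theta)$ tends to $\rho^\infty$ as $\theta\to+\infty$.
   Context: The method is applied to the scalar test equation $\dot u+\lambda_\theta u=0$ with step size $\tau>0$; put $\theta=\tau\lambda_\theta$. The unknowns at step $n$ are $W_n^{(0)},\dots,W_n^{(2k-1)}$, with $W_n^{(i)}$ approximating $u^{(i)}(t_n)$. The unknowns at step $n+1$ are determined as follows. For $j=1,\dots,k-1$, with $Q_{n,j}=W^{(2j-1)}_{n+1}-\sum_{i=0}^{2k-2j}\frac{\tau^i}{i!}W^{(2j-1+i)}_n$, $$\sum_{i=0}^{2k-2j}\frac{\tau^i}{i!}W^{(2j-1+i)}_n+\alpha_jQ_{n,j}=-\lambda_\theta W^{(2j-2)}_{n+1},\qquad W^{(2j-2)}_{n+1}=\sum_{i=0}^{2k-2j+1}\frac{\tau^i}{i!}W^{(2j-2+i)}_n+\tau\gamma_jQ_{n,j},$$ and $$W^{(2k-1)}_n+\alpha_k\big(W^{(2k-1)}_{n+1}-W^{(2k-1)}_n\big)=-\lambda_\theta\big(W^{(2k-2)}_n+\alpha_f(W^{(2k-2)}_{n+1}-W^{(2k-2)}_n)\big),$$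 $$W^{(2k-2)}_{n+1}=W^{(2k-2)}_n+\tau W^{(2k-1)}_n+\tau\gamma_k\big(W^{(2k-1)}_{n+1}-W^{(2k-1)}_n\big).$$ The amplification matrix $G=G(\theta)$ is the $2k\times2k$ matrix with $\mathbf U_{n+1}=G\,\mathbf U_n$, where $\mathbf U_n=(W^{(0)}_n,\tau W^{(1)}_n,\dots,\tau^{2k-1}W^{(2k-1)}_n)^T$. It is block upper triangular with $2\times2$ diagonal blocks $$G_j=\frac{1}{\alpha_j+\gamma_j\theta}\begin{bmatrix}\alpha_j&\alpha_j-\gamma_j\\-\theta&\alpha_j+(\gamma_j-1)\theta-1\end{bmatrix}\ (j=1,\dots,k-1),$$ $$G_k=\frac{1}{\alpha_k+\alpha_f\gamma_k\theta}\begin{bmatrix}\alpha_k+(\alpha_f-1)\gamma_k\theta&\alpha_k-\gamma_k\\-\theta&\alpha_k+\alpha_f(\gamma_k-1)\theta-1\end{bmatrix}.$$ The spectral radius is the maximum modulus of the eigenvalues. *)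

(* Defs.v *)
From mathcomp Require Import all_boot all_order all_algebra.
From mathcomp Require Import complex.
From mathcomp Require Import all_classical all_reals all_analysis.
From mathcomp Require Import ring lra zify.
Import Order.TTheory GRing.Theory Num.Theory.
Import numFieldNormedType.Exports.

Set Implicit Arguments.
Unset Strict Implicit.
Unset Printing Implicit Defensive.

Local Open Scope classical_set_scope.
Local Open Scope ring_scope.

(* The maximum modulus of the complex eigenvalues of a real matrix; for n > 0
   the set is finite and nonempty, so the supremum is a maximum. *)
Definition spectral_radius (R : realType) (n : nat) (A : 'M[R]_n) : R :=
  sup [set Normc.normc z | z in
        [set z : R[i] | eigenvalue (map_mx (real_complex R) A) z]].

(* sum_(i = 0)^(2k-1-m) tau^i / i! W^(m+i), the Taylor predictor for W^(m) that
   uses all the unknowns W^(m), ..., W^(2k-1). *)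
Definition predictor (R : realType) (k : nat) (tau : R) (W : nat -> R)
    (m : nat) : R :=
  \sum_(0 <= i < 2 * k - m) tau ^+ i / i`!%:R * W (m + i)%N.

(* One step W -> W' of the scheme for u' + lambda u = 0. Here W i stands for
   W_n^(i) and W' i for W_{n+1}^(i), and only the indices i < 2k matter;
   alpha and gamma are indexed from 1 to k. *)
Definition gen_alpha_step (R : realType) (k : nat) (alpha gamma : nat -> R)
    (alphaf lambda tau : R) (W W' : nat -> R) : Prop :=
  (forall j : nat, (1 <= j < k)%N ->
     let Q := W' (2 * j - 1)%N - predictor k tau W (2 * j - 1) in
     predictor k tau W (2 * j - 1) + alpha j * Q
       = - lambda * W' (2 * j - 2)%N
     /\
     W' (2 * j - 2)%N
       = predictor k tau W (2 * j - 2) + tau * gamma j * Q)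
  /\
  W (2 * k - 1)%N + alpha k * (W' (2 * k - 1)%N - W (2 * k - 1)%N)
    = - lambda * (W (2 * k - 2)%N
                  + alphaf * (W' (2 * k - 2)%N - W (2 * k - 2)%N))
  /\
  W' (2 * k - 2)%N
    = W (2 * k - 2)%N + tau * W (2 * k - 1)%N
      + tau * gamma k * (W' (2 * k - 1)%N - W (2 * k - 1)%N).

Definition scaled_vector (R : realType) (k : nat) (tau : R) (W : nat -> R) :
    'cV[R]_(2 * k) :=
  \col_i (tau ^+ i * W i).

Definition is_amplification_matrix (R : realType) (k : nat)
    (alpha gamma : nat -> R) (alphaf theta : R) (G : 'M[R]_(2 * k)) : Prop :=
  forall lambda tau : R, 0 < tau -> tau * lambda = theta ->
  forall W W' : nat -> R,
    gen_alpha_step k alpha gamma alphaf lambda tau W W' <->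
    scaled_vector k tau W' = G *m scaled_vector k tau W.
Arguments is_amplification_matrix {R} k alpha gamma alphaf theta G.

(* The amplification matrix exists and is unique as soon as the denominators
   of its diagonal blocks do not vanish. *)
Section WellDefined.
Variables (R : realType) (k : nat) (alpha gamma : nat -> R) (alphaf theta : R).
Hypothesis k_gt0 : (0 < k)%N.

Let taylor (m c : nat) : R := if (m <= c)%N then (c - m)`!%:R^-1 else 0.

Let correction (j c : nat) : R :=
  if (j < k)%N then
    - (theta * taylor (2 * j - 2) c + taylor (2 * j - 1) c)
      / (alpha j + gamma j * theta)
  else
    - (theta * taylor (2 * k - 2) c
       + (1 + (alphaf - 1) * theta) * taylor (2 * k - 1) c)
      / (alpha k + alphaf * gamma k * theta).

Let amplification : 'M[R]_(2 * k) :=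
  \matrix_(r, c) (taylor r c
    + (if odd r then 1 else gamma r./2.+1) * correction r./2.+1 c).

Let predictorE (tau : R) (W : nat -> R) (m : nat) : (m <= 2 * k)%N ->
  \sum_(c < 2 * k) taylor m c * (tau ^+ c * W c)
    = tau ^+ m * predictor k tau W m.
Proof.
move=> mk; rewrite -(big_mkord xpredT (fun c => taylor m c * (tau ^+ c * W c))).
rewrite (big_cat_nat (n := m)) //= big_nat_cond big1 ?add0r; last first.
  by move=> i /andP[/andP[_ im] _]; rewrite /taylor leqNgt im mul0r.
rewrite -{1}[m]add0n big_addn /predictor mulr_sumr.
apply: eq_bigr => i _; rewrite /taylor leq_addl addnK exprD addnC; ring.
Qed.

Lemma amplification_matrix_exists :
  (forall j : nat, (1 <= j < k)%N -> alpha j + gamma j * theta != 0) ->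
  alpha k + alphaf * gamma k * theta != 0 ->
  exists G, is_amplification_matrix k alpha gamma alphaf theta G.
Proof.
move=> nzj nzk; exists amplification => lambda tau tau0 tl W W'.
have tau_neq0 : tau != 0 by rewrite gt_eqF.
pose P := predictor k tau W.
pose q j := if (j < k)%N then
    - (lambda * P (2 * j - 2)%N + P (2 * j - 1)%N) / (alpha j + gamma j * theta)
  else - (lambda * P (2 * k - 2)%N
          + (1 + (alphaf - 1) * theta) * P (2 * k - 1)%N)
      / (alpha k + alphaf * gamma k * theta).
have qE j : (1 <= j <= k)%N ->
  \sum_(c < 2 * k) correction j c * (tau ^+ c * W c)
    = tau ^+ (2 * j - 1) * q j.
  move=> /andP[j1 jk]; have e1 : (2 * j - 1 = (2 * j - 2).+1)%N by lia.
  rewrite /correction /q; case: ltnP => [jk'|kj].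
    under eq_bigr do rewrite mulrAC mulNr mulrDl -mulrA.
    rewrite -mulr_suml sumrN big_split /= -mulr_sumr !predictorE; try lia.
    rewrite -/P e1 exprS -tl; field; rewrite tl; by apply: nzj; rewrite j1.
  have -> : j = k by lia.
  have {}e1 : (2 * k - 1 = (2 * k - 2).+1)%N by lia.
  under eq_bigr do rewrite mulrAC mulNr mulrDl -!mulrA.
  rewrite -mulr_suml sumrN big_split /= -!mulr_sumr !predictorE; try lia.
  rewrite -/P e1 exprS -tl; field; rewrite tl; exact: nzk.
have ampE (r : 'I_(2 * k)) : (amplification *m scaled_vector k tau W) r 0
    = tau ^+ r * (P r + (if odd r then 1 else tau * gamma r./2.+1) * q r./2.+1).
  rewrite mxE; under eq_bigr do rewrite !mxE mulrDl -mulrA.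
  have rk := ltn_ord r.
  rewrite big_split /= -mulr_sumr predictorE ?qE; try lia.
  case: ifPn => odr; rewrite -/P.
    have -> : (2 * r./2.+1 - 1 = r)%N by lia.
    ring.
  have -> : (2 * r./2.+1 - 1 = r.+1)%N by lia.
  rewrite exprS; ring.
have sysE : scaled_vector k tau W' = amplification *m scaled_vector k tau W <->
    forall j, (1 <= j <= k)%N ->
      W' (2 * j - 1)%N = P (2 * j - 1)%N + q j /\
      W' (2 * j - 2)%N = P (2 * j - 2)%N + tau * gamma j * q j.
  split=> [/matrixP E j jk|E].
    have l1 : (2 * j - 1 < 2 * k)%N by lia.
    have l2 : (2 * j - 2 < 2 * k)%N by lia.
    have := E (Ordinal l1) 0; have := E (Ordinal l2) 0.
    rewrite !ampE !mxE /=.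
    have -> : odd (2 * j - 1) by lia.
    have -> : odd (2 * j - 2) = false by lia.
    have -> : ((2 * j - 1)./2.+1 = j)%N by lia.
    have -> : ((2 * j - 2)./2.+1 = j)%N by lia.
    move=> /(mulfI (expf_neq0 _ tau_neq0)) -> /(mulfI (expf_neq0 _ tau_neq0)) ->.
    by rewrite mul1r.
  apply/matrixP => r c; rewrite ord1 ampE mxE; congr (_ * _).
  have rk := ltn_ord r.
  have [|E1 E2] := E r./2.+1; first lia.
  case: ifPn => odr.
    have e : (2 * r./2.+1 - 1 = r)%N by lia.
    by move: E1; rewrite e mul1r.
  have e : (2 * r./2.+1 - 2 = r)%N by lia.
  by move: E2; rewrite e.
have stepE (a g d l P0 P1 w0 w1 : R) : a + g * (tau * l) != 0 ->
    d = - (l * P0 + P1) / (a + g * (tau * l)) ->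
    (P1 + a * (w1 - P1) = - l * w0 /\ w0 = P0 + tau * g * (w1 - P1)) <->
    (w1 = P1 + d /\ w0 = P0 + tau * g * d).
  move=> nz ->; split=> [[E1 E2]|[-> ->]]; last by split; field.
  have dE : w1 - P1 = - (l * P0 + P1) / (a + g * (tau * l)).
    apply: (mulIf nz); rewrite divfK //; rewrite E2 in E1; lra.
  by rewrite -dE; split; [ring|].
have stepkE (a g d l P0 P1 w0 w1 : R) : a + alphaf * g * (tau * l) != 0 ->
    d = - (l * (P0 + tau * P1) + (1 + (alphaf - 1) * (tau * l)) * P1)
        / (a + alphaf * g * (tau * l)) ->
    (P1 + a * (w1 - P1) = - l * (P0 + alphaf * (w0 - P0)) /\
     w0 = P0 + tau * P1 + tau * g * (w1 - P1)) <->
    (w1 = P1 + d /\ w0 = P0 + tau * P1 + tau * g * d).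
  move=> nz ->; split=> [[E1 E2]|[-> ->]]; last by split; field.
  have dE : w1 - P1 = - (l * (P0 + tau * P1) + (1 + (alphaf - 1) * (tau * l)) * P1)
        / (a + alphaf * g * (tau * l)).
    apply: (mulIf nz); rewrite divfK //; rewrite E2 in E1; lra.
  by rewrite -dE; split; [ring|].
have PkE : P (2 * k - 1)%N = W (2 * k - 1)%N.
  rewrite /P /predictor; have -> : (2 * k - (2 * k - 1) = 1)%N by lia.
  by rewrite big_nat1 expr0 fact0 divr1 mul1r addn0.
have Pk2E : P (2 * k - 2)%N = W (2 * k - 2)%N + tau * W (2 * k - 1)%N.
  rewrite /P /predictor; have -> : (2 * k - (2 * k - 2) = 2)%N by lia.
  rewrite !big_nat_recl //= big_geq // addr0 expr0 expr1 !divr1 mul1r addn0.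
  by have -> : (2 * k - 2 + 1 = 2 * k - 1)%N by lia.
have qk : q k = - (lambda * (W (2 * k - 2)%N + tau * W (2 * k - 1)%N)
      + (1 + (alphaf - 1) * (tau * lambda)) * W (2 * k - 1)%N)
    / (alpha k + alphaf * gamma k * (tau * lambda)).
  by rewrite /q ltnn PkE Pk2E tl.
have nzk' : alpha k + alphaf * gamma k * (tau * lambda) != 0 by rewrite tl.
have lastE := stepkE _ _ _ _ _ _ (W' (2 * k - 2)%N) (W' (2 * k - 1)%N) nzk' qk.
rewrite sysE; split=> [[Sj Sk] j /andP[j1 jk]|S].
  have [jk'|kj] := ltnP j k.
    apply/(stepE (alpha j) (gamma j) (q j) lambda); rewrite ?tl ?nzj ?j1 //.
      by rewrite /q jk'.
    by apply: Sj; rewrite j1.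
  have -> : j = k by lia.
  by rewrite PkE Pk2E; apply/lastE.
split=> [j jk Q|].
  apply/(stepE (alpha j) (gamma j) (q j) lambda); rewrite ?tl ?nzj //.
    by rewrite /q; case/andP: jk => _ ->.
  by apply: S; lia.
by apply/lastE; rewrite -Pk2E -PkE; apply: S; lia.
Qed.

Lemma amplification_matrix_unique (G1 G2 : 'M[R]_(2 * k)) :
  is_amplification_matrix k alpha gamma alphaf theta G1 ->
  is_amplification_matrix k alpha gamma alphaf theta G2 -> G1 = G2.
Proof.
move=> H1 H2; have scaledE (u : 'cV[R]_(2 * k)) :
    exists W, scaled_vector k 1 W = u.
  exists (fun i => if insub i is Some o then u o 0 else 0).
  by apply/matrixP => i c; rewrite mxE valK expr1n mul1r ord1.
suff E u : G1 *m u = G2 *m u :> 'cV[R]_(2 * k).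
  by apply/trmx_inj/row_matrixP => i; rewrite -!tr_col !colE E.
have [[W <-] [W' W'E]] := (scaledE u, scaledE (G1 *m u)).
have [W2 W2E] := scaledE (G1 *m scaled_vector k 1 W).
have tl : 1 * theta = theta by rewrite mul1r.
by rewrite -W2E; apply/(H2 _ _ ltr01 tl)/(H1 _ _ ltr01 tl).
Qed.

End WellDefined.

(* Main.v *)
Require Import Defs.
From mathcomp Require Import all_boot all_order all_algebra.
From mathcomp Require Import complex.
From mathcomp Require Import all_classical all_reals all_analysis.
From mathcomp Require Import ring lra zify.
Import Order.TTheory GRing.Theory Num.Theory.
Import numFieldNormedType.Exports.

Local Open Scope classical_set_scope.
Local Open Scope ring_scope.

Set Implicit Arguments.
Unset Strict Implicit.

(** A left eigenvector of a block upper triangular matrix restricts to a left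
    eigenvector of the first block it meets, and one of the last block extends
    by zero, so only the quadratics [z^2 - tr z + det] of the 2x2 blocks matter.
    With [c = 1/(1+rho)], all [gamma_j] and [alphaf] equal [c]; as [theta] grows
    the first [k-1] quadratics tend to [z (z + rho)] and the last one tends to
    [(z + rho)^2]. Hence every eigenvalue has modulus at most [rho + eps]
    eventually, and the last block provides one whose modulus is near [rho]. *)

(** * Eigenvalues of block upper triangular matrices with 2x2 blocks *)

Fact even_index_subproof (k : nat) (j : 'I_k) : (2 * j < 2 * k)%N.
Proof. have := ltn_ord j; lia. Qed.

Fact odd_index_subproof (k : nat) (j : 'I_k) : (2 * j + 1 < 2 * k)%N.
Proof. have := ltn_ord j; lia. Qed.

Definition even_index (k : nat) (j : 'I_k) := Ordinal (even_index_subproof j).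
Definition odd_index (k : nat) (j : 'I_k) := Ordinal (odd_index_subproof j).

Section BlockTriangular.
Variables (F : fieldType) (k : nat) (A : 'M[F]_(2 * k)).

(** Indices start at 0, so [r./2] is the number of the block that contains [r]. *)
Definition block2_triangular :=
  forall r c : 'I_(2 * k), (c./2 < r./2)%N -> A r c = 0.

Definition block2_trace (j : 'I_k) : F :=
  A (even_index j) (even_index j) + A (odd_index j) (odd_index j).

Definition block2_det (j : 'I_k) : F :=
  A (even_index j) (even_index j) * A (odd_index j) (odd_index j)
  - A (even_index j) (odd_index j) * A (odd_index j) (even_index j).

Lemma sum_block2 (j : 'I_k) (f : 'I_(2 * k) -> F) :
  (forall r : 'I_(2 * k), r./2 != j :> nat -> f r = 0) ->
  \sum_r f r = f (even_index j) + f (odd_index j).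
Proof.
move=> f0; rewrite (bigD1 (even_index j)) //= (bigD1 (odd_index j)) /=;
  last first.
  by rewrite -val_eqE /=; lia.
rewrite big1 ?addr0 // => r; rewrite -!val_eqE /= => ne.
by apply: f0; lia.
Qed.

Lemma eigenvalue_block2_triangular (z : F) :
  block2_triangular -> eigenvalue A z ->
  exists j : 'I_k, z ^+ 2 - block2_trace j * z + block2_det j = 0.
Proof.
move=> tA /eigenvalueP[v vA v0].
have [r0 vr0] : exists r, v 0 r != 0 by apply/rV0Pn.
(* The block of [r] is the first one on which the left eigenvector is nonzero. *)
have [r vr rmin] := @arg_minnP _ r0 (fun r => v 0 r != 0) (fun r => r./2) vr0.
have rk : (r./2 < k)%N by have := ltn_ord r; lia.
pose j := Ordinal rk; exists j.
have colE (c : 'I_(2 * k)) : c./2 = j :> nat ->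
    v 0 (even_index j) * A (even_index j) c
    + v 0 (odd_index j) * A (odd_index j) c = z * v 0 c.
  move=> cj; have /matrixP/(_ 0 c) := vA; rewrite !mxE => <-.
  rewrite (sum_block2 (j := j)) // => s sj.
  (* Rows before block [j] have [v 0 s = 0] by minimality; rows after it have a zero entry in column
     [c] by triangularity. *)
  have [vs|vs] := eqVneq (v 0 s) 0; first by rewrite vs mul0r.
  rewrite tA ?mulr0 // cj.
  have /= := rmin _ vs; move: sj => /=; lia.
have Ee := colE (even_index j) ltac:(rewrite /=; lia).
have Eo := colE (odd_index j) ltac:(rewrite /=; lia).
move: Ee Eo; rewrite /block2_trace /block2_det.
set a := A _ _; set b := A _ _; set c := A _ _; set d := A _ _.
set x := v 0 _; set y := v 0 _ => Ee Eo.
have : x != 0 \/ y != 0.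
  have [rodd|rodd] := boolP (odd r).
    right; rewrite /y; suff <- : r = odd_index j by [].
    by apply: val_inj => /=; lia.
  left; rewrite /x; suff <- : r = even_index j by [].
  by apply: val_inj => /=; lia.
have e1 : (z - a) * x = b * y by rewrite mulrBl -Ee; ring.
have e2 : (z - d) * y = c * x by rewrite mulrBl -Eo; ring.
(* Multiplied by a nonzero coordinate of the eigenvector, the quadratic vanishes by [e1] and
   [e2]. *)
case=> nz; apply: (mulIf nz); rewrite mul0r.
  transitivity ((z - d) * ((z - a) * x) - b * (c * x)); first by ring.
  by rewrite e1 -e2; ring.
transitivity ((z - a) * ((z - d) * y) - c * (b * y)); first by ring.
by rewrite e2 -e1; ring.
Qed.

(** The explicit row [(c, z - a)], with [a], [c] the first column of the block, works: its first
    eigenvector equation is an identity, its second is the quadratic, and [c != 0] makes it nonzero.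
    Extended by zero it stays an eigenvector, since the rows of the last block vanish in all earlier
    columns. *)
Lemma last_block2_eigenvalue (j : 'I_k) (z : F) :
  block2_triangular -> (forall i : 'I_k, (i <= j)%N) ->
  A (odd_index j) (even_index j) != 0 ->
  z ^+ 2 - block2_trace j * z + block2_det j = 0 -> eigenvalue A z.
Proof.
move=> tA jmax; rewrite /block2_trace /block2_det.
set c := A (odd_index j) (even_index j).
set a := A (even_index j) (even_index j) => c0 qz.
pose v : 'rV[F]_(2 * k) := \row_r
  if r == even_index j then c else if r == odd_index j then z - a else 0.
have ve : v 0 (even_index j) = c by rewrite mxE eqxx.
have vo : v 0 (odd_index j) = z - a.
  by rewrite mxE eqxx ifN // -val_eqE /=; lia.
have v0 (r : 'I_(2 * k)) : r./2 != j :> nat -> v 0 r = 0.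
  by move=> rj; rewrite mxE !ifN // -val_eqE /=; lia.
apply/eigenvalueP; exists v; last first.
  by apply/rV0Pn; exists (even_index j); rewrite ve.
apply/rowP => s; rewrite [LHS]mxE [RHS]mxE (sum_block2 (j := j)); last first.
  by move=> r rj; rewrite v0 // mul0r.
rewrite ve vo.
have [sj|sj] := eqVneq (s./2) j; last first.
  have sk : (s./2 < k)%N by have := ltn_ord s; lia.
  have /= sj' := jmax (Ordinal sk).
  by rewrite v0 // !tA ?mulr0 ?addr0 //=; lia.
have [sodd|sodd] := boolP (odd s).
  have -> : s = odd_index j by apply: val_inj => /=; lia.
  rewrite vo; apply/eqP; rewrite -subr_eq0 -oppr_eq0; apply/eqP; rewrite -qz.
  rewrite -/c -/a; ring.
have -> : s = even_index j by apply: val_inj => /=; lia.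
by rewrite ve -/a -/c; ring.
Qed.

End BlockTriangular.

(** * Entries of the amplification matrix, read off from the scheme *)

Section Amplification.
Variables (R : realType) (k : nat) (alpha gamma : nat -> R) (alphaf theta : R).
Variable G : 'M[R]_(2 * k).
Hypothesis GP : is_amplification_matrix k alpha gamma alphaf theta G.

(** The scheme is run with [tau = 1], [lambda = theta], where the scaling is trivial. Starting from
    the unit vector [W c], one step produces column [c] of [G], which is [W' c]; its default value 0
    lies outside the indices below [2 * k]. *)
Let W (c : 'I_(2 * k)) (i : nat) : R := (i == c)%:R.
Let W' (c : 'I_(2 * k)) (i : nat) : R :=
  if insub i is Some r then G r c else 0.

Let W'E (r c : 'I_(2 * k)) : W' c r = G r c.
Proof. by rewrite /W' valK. Qed.

Let stepW (c : 'I_(2 * k)) :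
  gen_alpha_step k alpha gamma alphaf theta 1 (W c) (W' c).
Proof.
apply/(GP ltr01 (mul1r _)).
apply/colP => r; rewrite !mxE expr1n mul1r W'E (bigD1 c) //= big1.
  by rewrite !mxE expr1n mul1r /W eqxx mulr1 addr0.
by move=> i ic; rewrite !mxE /W /= val_eqE (negPf ic) !mulr0.
Qed.

Let predictorW (c : 'I_(2 * k)) (m : nat) :
  predictor k 1 (W c) m = if (m <= c)%N then (c - m)`!%:R^-1 else 0.
Proof.
have ck := ltn_ord c.
rewrite /predictor; case: leqP => [mc|cm]; last first.
  rewrite big_nat big1 // => i _; rewrite /W.
  have -> : (m + i == c)%N = false by lia.
  by rewrite mulr0.
rewrite big_mkord.
have cmk : (c - m < 2 * k - m)%N by lia.
rewrite (bigD1 (Ordinal cmk)) //= big1.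
  by rewrite /W subnKC // eqxx expr1n div1r mulr1 addr0.
move=> i; rewrite -val_eqE /= => ic; rewrite /W.
have -> : (m + i == c)%N = false by lia.
by rewrite mulr0.
Qed.

(** Inserting the second equation of the scheme into the first leaves a linear equation for the
    correction, [(alpha + gamma * theta) * q = - (theta * P0 + P1)]. Blocks count from 0 and the
    scheme from 1, hence [j.+1]. *)
Let blockP (j : 'I_k) (c : 'I_(2 * k)) (P0 := predictor k 1 (W c) (2 * j))
  (P1 := predictor k 1 (W c) (2 * j + 1)) :
  (j.+1 < k)%N -> alpha j.+1 + gamma j.+1 * theta != 0 ->
  let q := - (theta * P0 + P1) / (alpha j.+1 + gamma j.+1 * theta) in
  G (even_index j) c = P0 + gamma j.+1 * q /\ G (odd_index j) c = P1 + q.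
Proof.
move=> jk nz; have [+ _] := stepW c => /(_ j.+1 jk) /=.
have -> : (2 * j.+1 - 1 = 2 * j + 1)%N by lia.
have -> : (2 * j.+1 - 2 = 2 * j)%N by lia.
rewrite -/P0 -/P1.
have -> : W' c (2 * j)%N = G (even_index j) c by rewrite -W'E.
have -> : W' c (2 * j + 1)%N = G (odd_index j) c by rewrite -W'E.
set x := G (even_index j) c; set y := G (odd_index j) c => -[E1 E2].
have qE : y - P1 = - (theta * P0 + P1) / (alpha j.+1 + gamma j.+1 * theta).
  apply: (mulIf nz); rewrite divfK //.
  transitivity (P1 + alpha j.+1 * (y - P1) + theta * x - theta * P0 - P1).
    by rewrite E2; ring.
  by rewrite E1; ring.
by rewrite -qE; split; [rewrite E2; ring|ring].
Qed.

(** The same elimination for the last pair of equations, where the predictors are [w0 + w1] and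
    [w1]. *)
Let last_blockP (j : 'I_k) (c : 'I_(2 * k))
  (w0 := W c (2 * j)%N) (w1 := W c (2 * j + 1)%N) :
  j.+1 = k -> alpha k + alphaf * gamma k * theta != 0 ->
  let q := - (theta * (w0 + w1) + (1 + (alphaf - 1) * theta) * w1)
           / (alpha k + alphaf * gamma k * theta) in
  G (even_index j) c = w0 + w1 + gamma k * q /\ G (odd_index j) c = w1 + q.
Proof.
move=> jk nz; have [_ []] := stepW c.
have -> : (2 * k - 1 = 2 * j + 1)%N by lia.
have -> : (2 * k - 2 = 2 * j)%N by lia.
rewrite -/w0 -/w1.
have -> : W' c (2 * j)%N = G (even_index j) c by rewrite -W'E.
have -> : W' c (2 * j + 1)%N = G (odd_index j) c by rewrite -W'E.
set x := G (even_index j) c; set y := G (odd_index j) c => E1 E2.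
have qE : y - w1 = - (theta * (w0 + w1) + (1 + (alphaf - 1) * theta) * w1)
           / (alpha k + alphaf * gamma k * theta).
  apply: (mulIf nz); rewrite divfK //.
  transitivity (w1 + alpha k * (y - w1)
      + theta * (w0 + alphaf * (x - w0)) - theta * (w0 + w1)
      - (1 + (alphaf - 1) * theta) * w1); first by rewrite E2; ring.
  by rewrite E1; ring.
by rewrite -qE; split; [rewrite E2; ring|ring].
Qed.

(** A unit vector supported in an earlier block has zero predictors from index [2 * j] on, so the
    correction [q] and both new values vanish. *)
Lemma amplification_block2_triangular :
  (forall j : nat, (1 <= j < k)%N -> alpha j + gamma j * theta != 0) ->
  alpha k + alphaf * gamma k * theta != 0 -> block2_triangular G.
Proof.
move=> nz nzk r c cr.
have rk : (r./2 < k)%N by have := ltn_ord r; lia.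
pose j := Ordinal rk.
suff [E O] : G (even_index j) c = 0 /\ G (odd_index j) c = 0.
  have [rodd|rodd] := boolP (odd r).
    by rewrite -[RHS]O; congr (G _ _); apply: val_inj => /=; lia.
  by rewrite -[RHS]E; congr (G _ _); apply: val_inj => /=; lia.
have [jk|kj] := ltnP j.+1 k.
  have [-> ->] := blockP c jk (nz j.+1 jk).
  rewrite !predictorW !ifN -?ltnNge /=; try lia.
  by rewrite mulr0 !addr0 oppr0 mul0r mulr0 addr0.
have jk : j.+1 = k by move: kj (rk) => /=; lia.
have [-> ->] := last_blockP c jk nzk.
have -> : W c (2 * j)%N = 0.
  by rewrite /W /=; have -> : (2 * r./2 == c)%N = false by lia.
have -> : W c (2 * j + 1)%N = 0.
  by rewrite /W /=; have -> : (2 * r./2 + 1 == c)%N = false by lia.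
by rewrite !(mulr0, addr0, oppr0, mul0r).
Qed.

Let W_even (j : 'I_k) : W (even_index j) (2 * j)%N = 1.
Proof. by rewrite /W eqxx. Qed.
Let W_odd (j : 'I_k) : W (odd_index j) (2 * j + 1)%N = 1.
Proof. by rewrite /W eqxx. Qed.
Let W_even' (j : 'I_k) : W (even_index j) (2 * j + 1)%N = 0.
Proof. by rewrite /W /=; have -> : (2 * j + 1 == 2 * j)%N = false by lia. Qed.
Let W_odd' (j : 'I_k) : W (odd_index j) (2 * j)%N = 0.
Proof. by rewrite /W /=; have -> : (2 * j == 2 * j + 1)%N = false by lia. Qed.

Let P_even (j : 'I_k) : predictor k 1 (W (even_index j)) (2 * j) = 1.
Proof. by rewrite predictorW /= leqnn subnn fact0 invr1. Qed.
Let P_odd (j : 'I_k) : predictor k 1 (W (odd_index j)) (2 * j + 1) = 1.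
Proof. by rewrite predictorW /= leqnn subnn fact0 invr1. Qed.
Let P_even' (j : 'I_k) : predictor k 1 (W (even_index j)) (2 * j + 1) = 0.
Proof. by rewrite predictorW /= ifN //; lia. Qed.
Let P_odd' (j : 'I_k) : predictor k 1 (W (odd_index j)) (2 * j) = 1.
Proof. by rewrite predictorW /= leq_addr addKn factS fact0 invr1. Qed.

Lemma amplification_trace (j : 'I_k) :
  (j.+1 < k)%N -> alpha j.+1 + gamma j.+1 * theta != 0 ->
  block2_trace G j =
  (2 * alpha j.+1 - 1 + (gamma j.+1 - 1) * theta)
  / (alpha j.+1 + gamma j.+1 * theta).
Proof.
move=> jk nz; rewrite /block2_trace (blockP _ jk nz).1 (blockP _ jk nz).2.
by rewrite P_even P_even' P_odd P_odd'; field.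
Qed.

(** One factor of the squared denominator cancels, so this determinant decays like [1 / theta]: one
    root of the block goes to 0. *)
Lemma amplification_det (j : 'I_k) :
  (j.+1 < k)%N -> alpha j.+1 + gamma j.+1 * theta != 0 ->
  block2_det G j = (alpha j.+1 - 1) / (alpha j.+1 + gamma j.+1 * theta).
Proof.
move=> jk nz; rewrite /block2_det !(blockP _ jk nz).1 !(blockP _ jk nz).2.
by rewrite P_even P_even' P_odd P_odd'; field.
Qed.

Lemma amplification_last_trace (j : 'I_k) :
  j.+1 = k -> alpha k + alphaf * gamma k * theta != 0 ->
  block2_trace G j =
  (2 * alpha k - 1 + (2 * alphaf * gamma k - gamma k - alphaf) * theta)
  / (alpha k + alphaf * gamma k * theta).
Proof.
move=> jk nz; rewrite /block2_trace (last_blockP _ jk nz).1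
  (last_blockP _ jk nz).2.
by rewrite W_even W_even' W_odd W_odd'; field.
Qed.

Lemma amplification_last_det (j : 'I_k) :
  j.+1 = k -> alpha k + alphaf * gamma k * theta != 0 ->
  block2_det G j =
  ((alpha k + (alphaf - 1) * gamma k * theta)
   * (alpha k + alphaf * (gamma k - 1) * theta - 1)
   + theta * (alpha k - gamma k)) / (alpha k + alphaf * gamma k * theta) ^+ 2.
Proof.
move=> jk nz; rewrite /block2_det !(last_blockP _ jk nz).1
  !(last_blockP _ jk nz).2.
by rewrite W_even W_even' W_odd W_odd'; field.
Qed.

(** Supplies the nonzero corner entry that [last_block2_eigenvalue] asks for. *)
Lemma amplification_last_corner (j : 'I_k) :
  j.+1 = k -> alpha k + alphaf * gamma k * theta != 0 ->
  G (odd_index j) (even_index j)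
  = - theta / (alpha k + alphaf * gamma k * theta).
Proof.
by move=> jk nz; rewrite (last_blockP _ jk nz).2 W_even W_even'; field.
Qed.

End Amplification.

(** * Moduli of the roots of perturbed quadratics *)

Section QuadraticRoots.
Variables (R : realType) (rho delta eps : R).

(** If [eps <= x], then [f * y + g < delta * x + 2 * delta], which is at most
    [eps * x / 2 + eps ^+ 2 / 2], hence at most [x ^+ 2]. The two bounds on [delta] are chosen for
    this. *)
Let double_bound (x y f g : R) : 0 <= x -> 0 <= y -> y <= x + 1 ->
  0 < eps -> delta <= eps / 2 -> delta <= eps ^+ 2 / 4 ->
  0 <= f -> f < delta -> g < delta -> x ^+ 2 <= f * y + g -> x < eps.
Proof.
move=> x0 y0 yx eps0 delta1 delta2 f0 fd gd x_le.
rewrite ltNge; apply/negP => xge.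
have h1 : f * y <= delta * (x + 1) by apply: ler_pM => //; exact: ltW.
have h2 : delta * x <= eps / 2 * x by rewrite ler_wpM2r.
have h3 : eps * x <= x * x by rewrite ler_wpM2r.
have h4 : eps * eps <= eps * x by rewrite ler_pM2l.
by rewrite !expr2 in x_le delta2; lra.
Qed.

(** If [rho + eps <= x], comparing [(rho + eps) * x] with [(rho + eps / 2) * x + eps ^+ 2 / 4] gives
    [x < eps / 2], a contradiction. *)
Let simple_bound (x f g : R) : 0 <= x -> 0 <= rho ->
  0 < eps -> delta <= eps / 2 -> delta <= eps ^+ 2 / 4 ->
  f <= rho + delta -> g < delta -> x ^+ 2 <= f * x + g -> x < rho + eps.
Proof.
move=> x0 rho0 eps0 delta1 delta2 fd gd x_le; rewrite ltNge; apply/negP => xge.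
have f_le : f <= rho + eps / 2 by lra.
have h1 : f * x <= (rho + eps / 2) * x by rewrite ler_wpM2r.
have h3 : (rho + eps) * x <= x * x by rewrite ler_wpM2r.
have h4 : eps * (rho + eps) <= eps * x by rewrite ler_pM2l.
have h5 : 0 <= eps * rho by rewrite mulr_ge0 // ltW.
have h6 : 0 < eps * eps by rewrite mulr_gt0.
by rewrite !expr2 in x_le delta2; lra.
Qed.

Lemma normc_real_complex (x : R) : Normc.normc (real_complex R x) = `|x|.
Proof. by rewrite /Normc.normc /= expr0n /= addr0 sqrtr_sqr. Qed.

Let normcB (x y : R[i]) :
  Normc.normc (x - y) <= Normc.normc x + Normc.normc y.
Proof.
rewrite -[X in _ <= _ + X](@normcN R y).
exact: (@le_normcD R x (- y)).
Qed.

Let normc_ge0 (x : R[i]) : 0 <= Normc.normc x.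
Proof. by case: x => a b; apply: sqrtr_ge0. Qed.

(** With [w = z + rho] the equation reads [w ^+ 2 = e1 * z - e2]. The modulus of [z] exceeds that of
    [w] by at most [rho <= 1], so [double_bound] makes [w] small, and the moduli of [z] and [- rho]
    differ by at most that of [w]. *)
Lemma normc_root_double (e1 e2 : R) (z : R[i]) :
  0 <= rho <= 1 -> 0 < eps -> delta <= eps / 2 -> delta <= eps ^+ 2 / 4 ->
  `|e1| < delta -> `|e2| < delta ->
  z ^+ 2 - real_complex R (- 2 * rho + e1) * z + real_complex R (rho ^+ 2 + e2)
    = 0 ->
  `|Normc.normc z - rho| < eps.
Proof.
move=> /andP[rho0 rho1] eps0 delta1 delta2 e1_lt e2_lt qz.
set r := real_complex R rho; set w := z + r.
have rE : Normc.normc r = rho by rewrite normc_real_complex ger0_norm.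
have w2 : w * w = real_complex R e1 * z - real_complex R e2.
  apply/eqP; rewrite -subr_eq0 -qz; apply/eqP.
  rewrite /w /r !rmorphD rmorphM rmorphXn rmorphN rmorph_nat /=; ring.
have zw : Normc.normc z <= Normc.normc w + rho.
  by rewrite -rE -[X in Normc.normc X <= _](addrK r z); apply: normcB.
have wz : rho <= Normc.normc w + Normc.normc z.
  rewrite -[X in X <= _]rE -[X in Normc.normc X <= _](addKr z) addrC.
  exact: normcB.
have w_le : Normc.normc w ^+ 2 <= `|e1| * Normc.normc z + `|e2|.
  rewrite expr2 -Normc.normcM w2 -!normc_real_complex -Normc.normcM.
  exact: normcB.
clear qz w2.
have zw1 : Normc.normc z <= Normc.normc w + 1 by lra.
have w_lt := double_bound (normc_ge0 w) (normc_ge0 z) zw1 eps0 delta1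
  delta2 (normr_ge0 e1) e1_lt e2_lt w_le.
by rewrite ltr_norml; apply/andP; split; lra.
Qed.

(** The bound is one-sided because the unperturbed roots are 0 and [- rho]. *)
Lemma normc_root_simple (e1 e2 : R) (z : R[i]) :
  0 <= rho -> 0 < eps -> delta <= eps / 2 -> delta <= eps ^+ 2 / 4 ->
  `|e1| < delta -> `|e2| < delta ->
  z ^+ 2 - real_complex R (- rho + e1) * z + real_complex R e2 = 0 ->
  Normc.normc z < rho + eps.
Proof.
move=> rho0 eps0 delta1 delta2 e1_lt e2_lt qz.
have z2 : z * z = real_complex R (- rho + e1) * z - real_complex R e2.
  by apply/eqP; rewrite -subr_eq0 -qz; apply/eqP; ring.
have z_le : Normc.normc z ^+ 2 <= `|- rho + e1| * Normc.normc z + `|e2|.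
  rewrite expr2 -Normc.normcM z2 -!normc_real_complex -Normc.normcM.
  exact: normcB.
apply: simple_bound z_le => //.
by rewrite (le_trans (ler_normD _ _)) // normrN ger0_norm // lerD2l ltW.
Qed.

End QuadraticRoots.

(** * Tools for the limit: existence of a root, decay of the perturbations, the supremum *)

Lemma complex_quadratic_root (R : realType) (t d : R[i]) :
  exists z, z ^+ 2 - t * z + d = 0.
Proof.
exists ((t + sqrtC (t ^+ 2 - 4 * d)) / 2).
have s2 := sqrtCK (t ^+ 2 - 4 * d); set s := sqrtC _ in s2 *.
transitivity ((s ^+ 2 - (t ^+ 2 - 4 * d)) / 4); last by rewrite s2 subrr mul0r.
have n2 : (2 : R[i]) != 0 by rewrite pnatr_eq0.
have n4 : (4 : R[i]) != 0 by rewrite pnatr_eq0.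
by field; rewrite ?n2 ?n4.
Qed.

(** For [t > 1] the numerator is at most [(|a| + |b|) * t] in modulus and the denominator at least
    [(d * t) ^+ 2], so [t] beyond [(|a| + |b|) / (delta * d ^+ 2)] suffices. All deviations of
    traces and determinants are brought to this shape. *)
Lemma linear_div_sqr_near0 (R : realType) (a b c d delta : R) :
  0 <= c -> 0 < d -> 0 < delta ->
  \forall t \near +oo, `|(a + b * t) / (c + d * t) ^+ 2| < delta.
Proof.
move=> c0 d0 delta0.
near=> t.
have t1 : 1 < t by near: t; apply: nbhs_pinfty_gt; rewrite num_real.
have tM : (`|a| + `|b|) / (delta * d ^+ 2) < t.
  by near: t; apply: nbhs_pinfty_gt; rewrite num_real.
have t0 : 0 < t by lra.
have dt0 : 0 < d * t by rewrite mulr_gt0.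
rewrite ltr_pdivrMr in tM; last by rewrite mulr_gt0 ?exprn_gt0.
have D0 : 0 < (c + d * t) ^+ 2 by rewrite exprn_gt0 // ltr_wpDl.
rewrite normrM normfV (gtr0_norm D0) ltr_pdivrMr //.
apply: (@le_lt_trans _ _ ((`|a| + `|b|) * t)).
  rewrite (le_trans (ler_normD _ _)) // mulrDl normrM (gtr0_norm t0) lerD2r.
  by rewrite ler_peMr // ltW.
apply: (@lt_le_trans _ _ (delta * (d * t) ^+ 2)).
  rewrite -(ltr_pM2r t0) in tM.
  by rewrite exprMn !expr2 in tM *; lra.
rewrite ler_pM2l //; apply: lerXn2r; rewrite ?nnegrE.
- exact: ltW.
- exact/addr_ge0/ltW.
- by rewrite lerDr.
Unshelve. all: by end_near. Qed.

Lemma block2_trace_map (F K : fieldType) (f : {rmorphism F -> K}) (k : nat)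
    (A : 'M[F]_(2 * k)) (j : 'I_k) :
  block2_trace (map_mx f A) j = f (block2_trace A j).
Proof. by rewrite /block2_trace !mxE rmorphD. Qed.

Lemma block2_det_map (F K : fieldType) (f : {rmorphism F -> K}) (k : nat)
    (A : 'M[F]_(2 * k)) (j : 'I_k) :
  block2_det (map_mx f A) j = f (block2_det A j).
Proof. by rewrite /block2_det !mxE rmorphB !rmorphM. Qed.

(** The first hypothesis bounds the set of moduli and the second gives an element of it, so the
    supremum is a genuine one. *)
Lemma spectral_radius_near (R : realType) (n : nat) (A : 'M[R]_n) (r eps : R) :
  (forall z, eigenvalue (map_mx (real_complex R) A) z ->
     Normc.normc z <= r + eps) ->
  (exists2 z, eigenvalue (map_mx (real_complex R) A) z &
     r - eps <= Normc.normc z) ->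
  `|r - spectral_radius A| <= eps.
Proof.
move=> ub [z Az rz]; rewrite distrC ler_norml /spectral_radius.
set S := [set _ | _ in _].
have Sub : ubound S (r + eps) by move=> _ [w /= Aw <-]; apply: ub.
have Sz : S (Normc.normc z) by exists z.
have hS : has_sup S by split; [exists (Normc.normc z)|exists (r + eps)].
have h1 : sup S <= r + eps by apply: ge_sup => //; exists (Normc.normc z).
have h2 : Normc.normc z <= sup S by apply: ub_le_sup => //; case: hS.
by apply/andP; split; lra.
Qed.

(** * Convergence of the spectral radius *)

Unset Implicit Arguments.
Set Strict Implicit.

Theorem mainTheorem5 (R : realType) (k : nat) (rho : R)
    (alpha gamma : nat -> R) (alphaf : R) (G : R -> 'M[R]_(2 * k))
    (hk : (2 <= k)%N) (hrho : 0 <= rho <= 1)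
    (halpha : forall j : nat, (1 <= j < k)%N ->
       alpha j = 1 / 2 * ((3 + rho) / (1 + rho)))
    (hgamma : forall j : nat, (1 <= j < k)%N -> gamma j = alpha j - 1 / 2)
    (halphak : alpha k = 1 / 2 * ((3 - rho) / (1 + rho)))
    (halphaf : alphaf = 1 / (1 + rho))
    (hgammak : gamma k = 1 / 2 - alphaf + alpha k)
    (hG : forall theta : R, 0 < theta ->
       is_amplification_matrix k alpha gamma alphaf theta (G theta)) :
  spectral_radius (G theta) @[theta --> +oo] --> rho.
Proof.
have [jl jlk] : exists j : 'I_k, j.+1 = k.
  have kk : (k.-1 < k)%N by lia.
  by exists (Ordinal kk) => /=; lia.
have jl_max (i : 'I_k) : (i <= jl)%N by have := ltn_ord i; lia.
have /andP[rho0 rho1] := hrho.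
have rho1_gt0 : 0 < 1 + rho by lra.
have rho1_neq0 : 1 + rho != 0 by rewrite gt_eqF.
pose c := (1 + rho)^-1.
have c0 : 0 < c by rewrite invr_gt0.
have c_neq0 : c != 0 by rewrite gt_eqF.
have rhoE : rho = c^-1 - 1 by rewrite /c invrK addrC addKr.
have c2 : 0 < c ^+ 2 by rewrite exprn_gt0.
pose a := 1 / 2 * ((3 + rho) / (1 + rho)).
pose b := 1 / 2 * ((3 - rho) / (1 + rho)).
have a0 : 0 <= a by rewrite !mulr_ge0 // ?invr_ge0; lra.
have b0 : 0 <= b by rewrite !mulr_ge0 // ?invr_ge0; lra.
have gammaE j : (1 <= j < k)%N -> gamma j = c.
  by move=> jk; rewrite hgamma // halpha // /c; field.
have alphaE j : (1 <= j < k)%N -> alpha j = a by exact: halpha.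
have alphakE : alpha k = b by [].
have alphafE : alphaf = c by rewrite halphaf /c div1r.
have gammakE : gamma k = c by rewrite hgammak halphaf halphak /c; field.
(* From here [a], [b], [c] are opaque: the identities below are rational identities in them once
   [rho] is replaced by [c^-1 - 1]. *)
clearbody a b c; apply/cvgrPdist_le => eps eps0.
pose delta := Num.min (eps / 2) (eps ^+ 2 / 4).
have delta0 : 0 < delta by rewrite lt_min !divr_gt0 ?exprn_gt0.
have delta1 : delta <= eps / 2 by rewrite ge_min lexx.
have delta2 : delta <= eps ^+ 2 / 4 by rewrite ge_min lexx orbT.
(* The trace is [- rho + m / (a + c * theta)] for the first blocks and
   [- 2 * rho + mk / (b + c ^+ 2 * theta)] for the last one. *)
pose m := 2 * a - 1 + rho * a.
pose mk := 2 * b - 1 + 2 * rho * b.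
near=> theta.
have theta0 : 0 < theta by near: theta; apply: nbhs_pinfty_gt; rewrite num_real.
have D0 : 0 < a + c * theta by rewrite ltr_wpDl // mulr_gt0.
have Dk0 : 0 < b + c ^+ 2 * theta by rewrite ltr_wpDl // mulr_gt0.
have Dnz : a + c * theta != 0 by rewrite gt_eqF.
have Dknz : b + c ^+ 2 * theta != 0 by rewrite gt_eqF.
have nz j : (1 <= j < k)%N -> alpha j + gamma j * theta != 0.
  by move=> jk; rewrite gammaE // alphaE.
have nzk : alpha k + alphaf * gamma k * theta != 0.
  by rewrite gammakE alphafE alphakE -expr2.
have GP := hG theta theta0.
pose C : {rmorphism R -> R[i]} := real_complex R.
have tri : block2_triangular (map_mx C (G theta)).
  move=> r s sr; rewrite mxE.
  rewrite (amplification_block2_triangular GP nz nzk sr).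
  exact: (rmorph0 C).
(* Serves twice: for the upper bound on eigenvalues from the last block, and for the lower bound on
   the spectral radius. *)
have last_root (j : 'I_k) z : j.+1 = k ->
    z ^+ 2 - C (block2_trace (G theta) j) * z
      + C (block2_det (G theta) j) = 0 -> `|Normc.normc z - rho| < eps.
  move=> jk.
  rewrite (amplification_last_trace GP jk nzk).
  rewrite (amplification_last_det GP jk nzk).
  rewrite gammakE alphafE alphakE -!expr2 => qz.
  (* The deviations of trace and determinant from their limits; the theta^2 term
     of the latter vanishes because c - 1 = - rho c. *)
  apply: (@normc_root_double R rho delta eps
    ((mk * b + mk * c ^+ 2 * theta) / (b + c ^+ 2 * theta) ^+ 2)
    ((b * (b - 1) - rho ^+ 2 * b ^+ 2 +
       ((c - 1) * c * (2 * b - 1) + b - c - 2 * rho ^+ 2 * b * c ^+ 2) * theta)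
     / (b + c ^+ 2 * theta) ^+ 2)) => //.
  - by near: theta; apply: linear_div_sqr_near0.
  - by near: theta; apply: linear_div_sqr_near0.
  rewrite -{}[RHS]qz; congr (_ - C _ * _ + C _).
    by rewrite /mk rhoE; field; rewrite c_neq0 Dknz.
  by rewrite rhoE; field; rewrite c_neq0 Dknz.
apply: spectral_radius_near => [z|].
  move=> /(eigenvalue_block2_triangular tri)[j].
  rewrite (block2_trace_map C) (block2_det_map C) => qz.
  have [jk|kj] := ltnP j.+1 k; last first.
    have jk : j.+1 = k by apply/eqP; rewrite eqn_leq kj andbT; exact: ltn_ord.
    by have := last_root _ _ jk qz; rewrite ltr_norml => /andP[]; lra.
  move: qz; rewrite (amplification_trace GP jk (nz j.+1 jk)).
  rewrite (amplification_det GP jk (nz j.+1 jk)).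
  rewrite gammaE // alphaE // => qz; apply: ltW.
  (* The deviations are [m] and [a - 1] over [a + c * theta]; both fractions are expanded by this
     denominator to fit [linear_div_sqr_near0]. *)
  apply: (@normc_root_simple R rho delta eps
    ((m * a + m * c * theta) / (a + c * theta) ^+ 2)
    (((a - 1) * a + (a - 1) * c * theta) / (a + c * theta) ^+ 2)) => //.
  - by near: theta; apply: linear_div_sqr_near0.
  - by near: theta; apply: linear_div_sqr_near0.
  rewrite -{}[RHS]qz; congr (_ - C _ * _ + C _).
    by rewrite /m rhoE; field; rewrite c_neq0 Dnz.
  by field.
(* Either root of the last quadratic has modulus near [rho], so any one of them witnesses the lower
   bound. *)
have [z qz] := complex_quadratic_root (C (block2_trace (G theta) jl))
  (C (block2_det (G theta) jl)).
exists z; last first.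
  by have := last_root _ _ jlk qz; rewrite ltr_norml => /andP[]; lra.
apply: (last_block2_eigenvalue (j := jl)) => //.
  rewrite mxE (fmorph_eq0 C).
  rewrite (amplification_last_corner GP jlk nzk).
  by rewrite mulf_neq0 ?invr_eq0 // oppr_eq0 gt_eqF.
by rewrite (block2_trace_map C) (block2_det_map C).
Unshelve. all: by end_near. Qed.
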